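(* Let $E$ be an arbitrary directed graph and let $(H,S)\in\mathcal T_E$. Then $U_{H,S}$ is closed in $G_E^{(0)}$ if and only if the following two conditions are satisfied: (i) If $x\in E^\infty$ is such that $x^0\subseteq E^0\setminus H$, then there exists $N\in\mathbb N$ such that $\mathrm{Path}(r(x_N),H)=\emptyset$. (ii) If $v\in E^0$ is such that $|\{e\in E^1: s(e)=v\text{ and }\mathrm{Path}(r(e),H)\neq\emptyset\}|=\infty$, then $v\in H\cup S$.
   Context: Graphs. A directed graph $E=(E^0,E^1,r,s)$ consists of disjoint sets $E^0$ (vertices), $E^1$ (edges) of arbitrary cardinality and maps $r,s:E^1\to E^0$ (range, source). A vertex $v$ is a sink if $s^{-1}(v)=\emptyset$, an infinite emitter if $s^{-1}(v)$ is infinite, and regular otherwise; $\mathrm{Inf}(E)$ is the set of infinite emitters. A finite path is either a vertex $v$ (length $0$, $s(v)=r(v)=v$) or a sequence $\mu=\mu_1\cdots\mu_n$ of edges with $r(\mu_i)=s(\mu_{i+1})$, with $s(\mu)=s(\mu_1)$, $r(\mu)=r(\mu_n)$, $|\mu|=n$. $\mathrm{Path}(E)$ is the set of finite paths and $E^\infty$ the set of infinite paths $x=x_1x_2\cdots$ ($r(x_i)=s(x_{i+1})$ for all $i$), with $s(x)=s(x_1)$; $x^0$ is the set of vertices of $x$, i.e. $s(x)$ and all $r(x_i)$. Convention: $r(x_0):=s(x)$. For $v\in E^0$ and $Y\subseteq E^0$, $\mathrm{Path}(v,Y)$ is the set of finite paths $\alpha$ (including length $0$) with $s(\alpha)=v$,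 $r(\alpha)\in Y$. A set $H\subseteq E^0$ is hereditary if, whenever there is a path from $v\in H$ to $w$, then $w\in H$; a hereditary set $H$ is saturated if every regular vertex $v$ with $r(s^{-1}(v))\subseteq H$ lies in $H$. For $H$ hereditary, the set of breaking vertices is $B_H=\{v\in E^0\setminus H : v\in\mathrm{Inf}(E),\ 0<|s^{-1}(v)\cap r^{-1}(E^0\setminus H)|<\infty\}$. $\mathcal T_E=\{(H,S): H\subseteq E^0 \text{ hereditary and saturated},\ S\subseteq B_H\}$. The space. $G_E^{(0)}=X=E^\infty\cup\{\mu\in\mathrm{Path}(E): r(\mu)\text{ is a sink or an infinite emitter}\}$ (the unit space of the graph groupoid of $E$). For $\mu\in\mathrm{Path}(E)$ put $Z(\mu)=\{\mu x: x\in X,\ s(x)=r(\mu)\}$, and for finite $F\subseteq s^{-1}(r(\mu))$ put $Z(\mu\setminus F)=Z(\mu)\setminus\bigcup_{e\in F}Z(\mu e)$. The sets $Z(\mu\setminus F)$ form a basis of compact open sets for a Hausdorff topology on $G_E^{(0)}$. For $(H,S)\in\mathcal T_E$: $U_H=\{x\in G_E^{(0)}: r(x_n)\in H\text{ for some }n\ge 0\}$, $U_S=\{\alpha\in\mathrm{Path}(E): r(\alpha)\in S\}$, $U_{H,S}=U_H\sqcup U_S$. *)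

(* Defs.v *)
From HB Require Import structures.
From mathcomp Require Import all_boot all_order.
From mathcomp Require Import boolp classical_sets functions cardinality.
From mathcomp Require Import topology.

Set Implicit Arguments.
Unset Strict Implicit.
Unset Printing Implicit Defensive.

Local Open Scope classical_set_scope.

Record digraph := Digraph {
  vertex : Type;
  edge : Type;
  erange : edge -> vertex;
  esource : edge -> vertex
}.

Section Vertices.
Variable E : digraph.

Definition out_edges (v : vertex E) : set (edge E) := [set e | esource e = v].

Definition sink (v : vertex E) : Prop := out_edges v = set0.

Definition infinite_emitter (v : vertex E) : Prop := infinite_set (out_edges v).

Definition regular (v : vertex E) : Prop := ~ sink v /\ ~ infinite_emitter v.

End Vertices.

Section Paths.
Variable E : digraph.

Fixpoint walk (v : vertex E) (l : seq (edge E)) : Prop :=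
  if l is e :: l' then esource e = v /\ walk (erange e) l' else True.

(* The source is stored separately so that a vertex [v] is the path of length
   0 given by [v] and [[::]]; for nonempty paths [walk] forces it to be the
   source of the first edge. *)
Record finite_path := FinitePath {
  psource : vertex E;
  pedges : seq (edge E);
  pedgesP : walk psource pedges
}.

Definition plength (mu : finite_path) : nat := size (pedges mu).

(* [pvertex mu n] is r(mu_n), with r(mu_0) = s(mu); meaningful for
   n <= |mu|. *)
Definition pvertex (mu : finite_path) (n : nat) : vertex E :=
  last (psource mu) (map (@erange E) (take n (pedges mu))).

Definition prange (mu : finite_path) : vertex E :=
  last (psource mu) (map (@erange E) (pedges mu)).

(* Path(v, Y) *)
Definition paths (v : vertex E) (Y : set (vertex E)) : set finite_path :=
  [set alpha | psource alpha = v /\ Y (prange alpha)].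

(* Edges are numbered from 0: [iedge x i] is x_(i+1). *)
Record infinite_path := InfinitePath {
  iedge : nat -> edge E;
  iedgeP : forall i, erange (iedge i) = esource (iedge i.+1)
}.

Definition isource (x : infinite_path) : vertex E := esource (iedge x 0).

(* [ivertex x n] is r(x_n), with the convention r(x_0) = s(x). *)
Definition ivertex (x : infinite_path) (n : nat) : vertex E :=
  if n is i.+1 then erange (iedge x i) else isource x.

(* x^0 *)
Definition ivertices (x : infinite_path) : set (vertex E) := range (ivertex x).

Inductive unit_space :=
  | UInfinite of infinite_path
  | UFinite (mu : finite_path) of
      sink (prange mu) \/ infinite_emitter (prange mu).

Definition usource (x : unit_space) : vertex E :=
  match x with
  | UInfinite y => isource y
  | UFinite mu _ => psource mu
  end.

End Paths.

Arguments UInfinite {E}.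
Arguments UFinite {E}.

Section Concatenation.
Variable E : digraph.
Implicit Types (mu nu : finite_path E) (x y : unit_space E).

Lemma walk_cat v (l1 l2 : seq (edge E)) :
  walk v (l1 ++ l2) <->
  walk v l1 /\ walk (last v (map (@erange E) l1)) l2.
Proof.
elim: l1 v => [|e l IH] v /=; first by split=> [//|[]].
split=> [[-> /IH[]]//|[[-> ?] ?]]; split=> //; exact/IH.
Qed.

Lemma pcat_subproof mu nu (h : psource nu = prange mu) :
  walk (psource mu) (pedges mu ++ pedges nu).
Proof.
apply/walk_cat; split; first exact: pedgesP.
by rewrite -/(prange mu) -h; exact: pedgesP.
Qed.

Definition pcat mu nu (h : psource nu = prange mu) : finite_path E :=
  FinitePath (pcat_subproof h).

Fixpoint scat (l : seq (edge E)) (f : nat -> edge E) : nat -> edge E :=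
  if l is e :: l' then fun i => if i is j.+1 then scat l' f j else e else f.

Lemma scatP v l (f : nat -> edge E) :
  walk v l -> esource (f 0) = last v (map (@erange E) l) ->
  (forall i, erange (f i) = esource (f i.+1)) ->
  esource (scat l f 0) = v /\
  forall i, erange (scat l f i) = esource (scat l f i.+1).
Proof.
elim: l v => [|e l IH] v /=; first by move=> _ ->.
move=> [ev wl] f0 fS; have [s0 sS] := IH _ wl f0 fS.
by split=> // -[|i]; [rewrite s0|exact: sS].
Qed.

Lemma icat_subproof mu (x : infinite_path E) (h : isource x = prange mu) i :
  erange (scat (pedges mu) (iedge x) i) =
  esource (scat (pedges mu) (iedge x) i.+1).
Proof.
by have [_] := scatP (pedgesP mu) h (@iedgeP _ x); exact.
Qed.

Definition icat mu (x : infinite_path E) (h : isource x = prange mu) :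
    infinite_path E :=
  InfinitePath (icat_subproof h).

Lemma prange_pcat mu nu (h : psource nu = prange mu) :
  prange (pcat h) = prange nu.
Proof. by rewrite /prange /= map_cat last_cat -/(prange mu) -h. Qed.

Lemma ucat_subproof mu nu (h : psource nu = prange mu) :
  sink (prange nu) \/ infinite_emitter (prange nu) ->
  sink (prange (pcat h)) \/ infinite_emitter (prange (pcat h)).
Proof. by rewrite prange_pcat. Qed.

Definition ucat mu (x : unit_space E) : usource x = prange mu -> unit_space E :=
  match x with
  | UInfinite y => fun h => UInfinite (icat h)
  | UFinite nu p => fun h => UFinite (pcat h) (ucat_subproof h p)
  end.

Definition edge_path (e : edge E) : finite_path E :=
  @FinitePath E (esource e) [:: e] (conj erefl I).

(* Z(mu) *)
Definition cylinder mu : set (unit_space E) :=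
  [set y | exists (x : unit_space E) (h : usource x = prange mu), y = ucat h].

(* Z(mu \ F), for [F] contained in [out_edges (prange mu)] *)
Definition cylinder_minus mu (F : set (edge E)) : set (unit_space E) :=
  cylinder mu `\`
  [set y | exists (e : edge E) (h : psource (edge_path e) = prange mu),
     F e /\ cylinder (pcat h) y].

Definition basic_sets : set (set (unit_space E)) :=
  [set A | exists (mu : finite_path E) (F : set (edge E)),
     [/\ finite_set F, F `<=` out_edges (prange mu) &
         A = cylinder_minus mu F]].

End Concatenation.

Section Topology.
Variable E : digraph.
Implicit Types (mu nu : finite_path E) (x y : unit_space E).

Lemma finite_path_eq mu nu :
  psource mu = psource nu -> pedges mu = pedges nu -> mu = nu.
Proof.
case: mu nu => [v l p] [w k q] /= vw lk.
by case: _ / vw in q *; case: _ / lk in q *; rewrite (Prop_irrelevance p q).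
Qed.

Lemma infinite_path_eq (x y : infinite_path E) : iedge x =1 iedge y -> x = y.
Proof.
case: x y => [f p] [g q] /= /funext fg.
by case: _ / fg in q *; rewrite (Prop_irrelevance p q).
Qed.

Lemma UFinite_eq mu nu p q : mu = nu -> UFinite mu p = UFinite nu q.
Proof. by move=> mn; case: _ / mn in q *; rewrite (Prop_irrelevance p q). Qed.

Lemma scat_cat (l k : seq (edge E)) f : scat (l ++ k) f =1 scat l (scat k f).
Proof. by elim: l => [|e l IH] // -[|i] /=. Qed.

Lemma usource_ucat mu x (h : usource x = prange mu) :
  usource (ucat h) = psource mu.
Proof.
case: x h => [x|nu p] //= h.
by have [] := scatP (pedgesP mu) h (@iedgeP _ x).
Qed.

Definition uedge x (i : nat) : option (edge E) :=
  match x with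
  | UInfinite y => Some (iedge y i)
  | UFinite mu _ => onth (pedges mu) i
  end.

Lemma cylinder_source mu x : cylinder mu x -> usource x = psource mu.
Proof. by move=> [y [h ->]]; exact: usource_ucat. Qed.

Lemma cylinder_edge mu x i :
  cylinder mu x -> i < plength mu -> uedge x i = onth (pedges mu) i.
Proof.
rewrite /plength; move=> [[y|nu p] [h ->]] /=.
  by elim: (pedges mu) i => [|e l IH] [|i] //= ?; exact: IH.
by elim: (pedges mu) i => [|e l IH] [|i] //= ?; exact: IH.
Qed.

Lemma cylinder_pcat mu nu (h : psource nu = prange mu) :
  cylinder (pcat h) `<=` cylinder mu.
Proof.
move=> _ [x [k ->]].
have xn : usource x = prange nu by rewrite k prange_pcat.
have hn : usource (ucat xn) = prange mu by rewrite usource_ucat.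
exists (ucat xn), hn.
case: x k xn hn => [x|rho p] k xn hn /=.
  by congr UInfinite; apply: infinite_path_eq => i /=; exact: scat_cat.
by apply: UFinite_eq; apply: finite_path_eq => //=; rewrite catA.
Qed.

Lemma cylinder_prefix mu nu x :
  cylinder mu x -> cylinder nu x -> plength mu <= plength nu ->
  exists2 l, psource nu = psource mu & pedges nu = pedges mu ++ l.
Proof.
move=> mx nx lmn; exists (drop (plength mu) (pedges nu)).
  by rewrite -(cylinder_source mx) (cylinder_source nx).
rewrite -[LHS](cat_take_drop (plength mu)); congr (_ ++ _).
have : forall i, i < plength mu -> onth (pedges nu) i = onth (pedges mu) i.
  move=> i im; rewrite -(cylinder_edge mx im) (cylinder_edge nx) //.
  exact: leq_trans im lmn.
move: lmn; rewrite /plength; move: (pedges mu) (pedges nu).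
elim=> [|e l IH] [|f k] //= lk ef.
have [->] := ef 0 isT; congr (_ :: _); apply: IH => // i il.
exact: (ef i.+1 il).
Qed.

Lemma cylinder_minus_join mu nu F G x : finite_set F -> finite_set G ->
  F `<=` out_edges (prange mu) -> G `<=` out_edges (prange nu) ->
  cylinder_minus mu F x -> cylinder_minus nu G x ->
  plength mu <= plength nu ->
  exists A, [/\ basic_sets A, A x &
    A `<=` cylinder_minus mu F `&` cylinder_minus nu G].
Proof.
move=> Ff Gf Fm Gn mFx nGx lmn.
have [mx nFx] := mFx; have [nx nG] := nGx.
have [[|e l] snm enm] := cylinder_prefix mx nx lmn.
  have mn : nu = mu by apply: finite_path_eq; rewrite // enm cats0.
  subst nu; exists (cylinder_minus mu (F `|` G)); split.
  - exists mu, (F `|` G); split=> //; first by rewrite finite_setU.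
    by move=> e [/Fm|/Gn].
  - split=> // -[e [h [[Fe|Ge] c]]]; first by apply: nFx; exists e, h.
    by apply: nG; exists e, h.
  - move=> y [my nFGy]; split; split=> // -[e [h [Fe c]]]; apply: nFGy.
      by exists e, h; split=> //; left.
    by exists e, h; split=> //; right.
have := pedgesP nu; rewrite enm snm => /walk_cat [_ /= [he wl]].
have hm : psource (edge_path e) = prange mu by [].
pose rho : finite_path E := FinitePath wl.
have hr : psource rho = prange (pcat hm) by rewrite prange_pcat.
have nE : nu = pcat hr.
  by apply: finite_path_eq; rewrite //= enm -catA.
have ne : cylinder nu `<=` cylinder (pcat hm) by rewrite nE; exact: cylinder_pcat.
exists (cylinder_minus nu G); split=> //; first by exists nu, G.
move=> y nGy; split=> //; have [ny _] := nGy; split.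
  exact: (cylinder_pcat (ne _ ny)).
move=> [f [hf [Ff' fy]]]; apply: nFx; exists f, hf; split=> //.
have lt1 g : plength mu < size (pedges mu ++ [:: g]).
  by rewrite size_cat addn1.
have := cylinder_edge fy (lt1 f); rewrite (cylinder_edge (ne _ ny) (lt1 e)) /=.
have on g : onth (pedges mu ++ [:: g]) (plength mu) = Some g.
  by rewrite /plength; elim: (pedges mu).
rewrite !on => -[ef]; subst f.
by rewrite (Prop_irrelevance hf hm); exact: ne.
Qed.

Lemma basic_sets_cover :
  \bigcup_(A in @basic_sets E) (A : set (unit_space E)) = setT.
Proof.
rewrite predeqE => x; split=> // _.
pose mu : finite_path E := @FinitePath E (usource x) [::] I.
exists (cylinder_minus mu set0); first by exists mu, set0; split.
split; last by move=> [e [h []]].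
exists x, erefl; case: x @mu => [y|nu p] mu /=.
  by congr UInfinite; exact: infinite_path_eq.
by apply: UFinite_eq; exact: finite_path_eq.
Qed.

Lemma basic_sets_join (A B : set (unit_space E)) x :
  basic_sets A -> basic_sets B -> A x -> B x ->
  exists C, [/\ basic_sets C, C x & C `<=` A `&` B].
Proof.
move=> [mu [F [Ff Fm ->]]] [nu [G [Gf Gn ->]]] Ax Bx.
have [lmn|/ltnW lnm] := leqP (plength mu) (plength nu).
  exact: cylinder_minus_join.
rewrite setIC; exact: cylinder_minus_join.
Qed.

HB.instance Definition _ := gen_eqMixin (unit_space E).
HB.instance Definition _ := gen_choiceMixin (unit_space E).
HB.instance Definition _ := @isBaseTopological.Build (unit_space E)
  (set (unit_space E)) (@basic_sets E) id basic_sets_cover basic_sets_join.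

Lemma open_unit_spaceP (A : set (unit_space E)) :
  open A <-> exists2 D, D `<=` @basic_sets E & \bigcup_(B in D) B = A.
Proof. by split=> -[D DE <-]; exists D. Qed.

End Topology.

Section AdmissiblePairs.
Variable E : digraph.
Implicit Types H S : set (vertex E).

Definition hereditary H : Prop :=
  forall mu : finite_path E, H (psource mu) -> H (prange mu).

Definition saturated H : Prop :=
  forall v : vertex E,
    regular v -> (@erange E) @` out_edges v `<=` H -> H v.

Definition breaking_vertices H : set (vertex E) :=
  [set v | [/\ ~ H v, infinite_emitter v,
     out_edges v `&` (@erange E) @^-1` (~` H) !=set0 &
     finite_set (out_edges v `&` (@erange E) @^-1` (~` H))]].

(* T_E *)
Definition admissible_pairs : set (set (vertex E) * set (vertex E)) :=
  [set HS | [/\ hereditary HS.1, saturated HS.1 &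
     HS.2 `<=` breaking_vertices HS.1]].

Definition U_hereditary H : set (unit_space E) :=
  [set x | match x with
           | UInfinite y => exists n, H (ivertex y n)
           | UFinite mu _ => exists2 n, n <= plength mu & H (pvertex mu n)
           end].

(* When [S] consists of infinite emitters, every finite path with range in
   [S] is a point of [unit_space E]. *)
Definition U_breaking S : set (unit_space E) :=
  [set x | match x with
           | UInfinite _ => False
           | UFinite alpha _ => S (prange alpha)
           end].

Definition U_pair H S : set (unit_space E) := U_hereditary H `|` U_breaking S.

End AdmissiblePairs.

(* Main.v *)
(** Write R for the set of vertices from which H can be reached.  Every vertex
of R is the source of a point of U_{H,S}, and conversely the source of every
point of U_{H,S} lies in R: a point of U_S ends at a breaking vertex, which
emits an edge into H.  Moreover mu x lies in U_{H,S} exactly when x does, so a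
set Z(mu \ F) misses U_{H,S} precisely when F absorbs all the edges emitted by
r(mu) into R and the point mu, if it is one, is outside U_{H,S}.  Condition (i)
says that infinite paths outside U_{H,S} have such neighbourhoods, condition
(ii) that finite ones do. *)
Require Import Defs.
From mathcomp Require Import all_boot all_order.
From mathcomp Require Import boolp classical_sets functions cardinality.
From mathcomp Require Import topology.

Set Implicit Arguments.
Unset Strict Implicit.
Unset Printing Implicit Defensive.

Local Open Scope classical_set_scope.

(** * Concatenation, initial segments and basic neighbourhoods in the unit space *)

Section UnitSpace.
Context {E : digraph}.
Implicit Types (mu nu : finite_path E) (x y z : unit_space E).

Definition vertex_path (v : vertex E) : finite_path E :=
  @FinitePath E v [::] I.

(** Associativity of concatenation. The matching conditions are independent variables, so that the
    equation applies whatever proofs of them occur. *)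
Lemma ucat_pcat mu nu x (h : psource nu = prange mu)
    (k : usource x = prange nu) (k' : usource x = prange (pcat h))
    (l : usource (ucat k) = prange mu) :
  ucat l = ucat k'.
Proof.
case: x k k' l => [x|rho p] k k' l /=.
  by congr UInfinite; apply: infinite_path_eq => i /=; rewrite scat_cat.
by apply: UFinite_eq; apply: finite_path_eq => //=; rewrite catA.
Qed.

Lemma uedge_ucat mu x (h : usource x = prange mu) i :
  uedge (ucat h) (plength mu + i) = uedge x i.
Proof.
rewrite /plength; case: x h => [y|nu p] h /=.
  by congr Some; elim: (pedges mu).
by elim: (pedges mu).
Qed.

Lemma uedge_ucat_edge e x (h : usource x = prange (edge_path e)) :
  uedge (ucat h) 0 = Some e.
Proof. by case: x h. Qed.

Lemma uedge0_Some x e : uedge x 0 = Some e ->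
  exists y (h : usource y = prange (edge_path e)), x = ucat h.
Proof.
case: x => [x|mu p] /=.
  move=> [<-].
  exists (UInfinite (InfinitePath (fun i => @iedgeP _ x i.+1))).
  exists (esym (@iedgeP _ x 0)).
  by congr UInfinite; apply: infinite_path_eq => -[].
case: mu p => v [|f l] // w p [fe]; subst f; have [ev wl] := w.
exists (UFinite (FinitePath wl) p), erefl.
by apply: UFinite_eq; apply: finite_path_eq => //=.
Qed.

Lemma uedge0_None x : uedge x 0 = None ->
  exists p, x = UFinite (vertex_path (usource x)) p.
Proof.
case: x => [x|[v [|e l] w] p] //= _; exists p.
by apply: UFinite_eq; exact: finite_path_eq.
Qed.

Lemma UFinite_ucat mu p :
  exists (q : sink (prange mu) \/ infinite_emitter (prange mu))
    (h : usource (UFinite (vertex_path (prange mu)) q) = prange mu),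
    UFinite mu p = ucat h.
Proof.
exists p, erefl; apply: UFinite_eq.
by apply: finite_path_eq => //=; rewrite cats0.
Qed.

(** Supplies the initial segment of length [N]: each induction step moves the first edge of the tail
    [y] to the end of the prefix. *)
Lemma UInfinite_ucat (x : infinite_path E) N :
  exists mu y (h : usource y = prange mu),
    [/\ UInfinite x = ucat h, plength mu = N & prange mu = ivertex x N].
Proof.
elim: N => [|N [mu [y [h [xE muN _]]]]].
  exists (vertex_path (isource x)), (UInfinite x), erefl; split=> //.
  by congr UInfinite; exact: infinite_path_eq.
have yN : uedge y 0 = Some (iedge x N) by rewrite -(uedge_ucat h) -xE addn0 muN.
have [z [k yE]] := uedge0_Some yN; subst y.
have hy : psource (edge_path (iedge x N)) = prange mu.
  by rewrite -h usource_ucat.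
have kz : usource z = prange (pcat hy) by rewrite k prange_pcat.
exists (pcat hy), z, kz; split.
- by rewrite xE; exact: ucat_pcat.
- by rewrite /plength size_cat addn1 -/(plength mu) muN.
- by rewrite prange_pcat.
Qed.

(** Call a vertex dead if no point starts there. A dead vertex is not a sink, and the edges it emits
    end at dead vertices, since a point could otherwise be prolonged backwards. Dependent choice
    then yields an infinite path from [v], which is a point. *)
Lemma exists_usource (v : vertex E) : exists x, usource x = v.
Proof.
pose dead v := forall x, usource x <> v.
apply: contrapT => /forallNP dv; change (dead v) in dv.
have step w : dead w -> exists e, esource e = w /\ dead (erange e).
  move=> dw; have [e ew] : exists e, esource e = w.
    apply: contrapT => /forallNP ne.
    have p : sink (prange (vertex_path w)).
      by apply/seteqP; split=> // e; exact: ne.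
    by apply: (dw (UFinite (vertex_path w) (or_introl p))).
  exists e; split=> // x xe; apply: (dw (@ucat E (edge_path e) x xe)).
  by rewrite usource_ucat.
have [e0 [e0v de0]] := step v dv.
(* Choosing edges with dead range, rather than dead vertices, makes the relation total and the
   chosen sequence itself the infinite path. *)
pose T := {e : edge E | dead (erange e)}.
have next (a : T) : {b : T | erange (sval a) = esource (sval b)}.
  case: a => e de; apply: cid; have [e' [ee' de']] := step _ de.
  by exists (exist _ e' de').
have [f [f0 fS]] := dependent_choice next (exist _ e0 de0).
apply: (dv (UInfinite (@InfinitePath E (fun n => sval (f n)) fS))).
by rewrite /= /isource /= f0.
Qed.

(** A point mu x lies in Z(mu e) exactly when x begins with e, so removing [F] restricts only the
    first edge after [mu]. *)
Lemma cylinder_minusP mu (F : set (edge E)) z : F `<=` out_edges (prange mu) ->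
  cylinder_minus mu F z <->
  exists x (h : usource x = prange mu),
    z = ucat h /\ forall e, F e -> uedge x 0 <> Some e.
Proof.
move=> Fmu; split=> [[[x [h zE]] nF]|[x [h [-> nF]]]].
  exists x, h; split=> // e Fe /uedge0_Some[y [k xE]]; subst x.
  have he : psource (edge_path e) = prange mu by exact: Fmu.
  have ky : usource y = prange (pcat he) by rewrite k prange_pcat.
  apply: nF; exists e, he; split=> //; exists y, ky.
  by rewrite zE; exact: ucat_pcat.
split; first by exists x, h.
move=> [e [he [Fe c]]]; apply: (nF e Fe).
rewrite -(uedge_ucat h) addn0 (cylinder_edge c) /plength /=.
  by elim: (pedges mu).
by rewrite size_cat addn1.
Qed.

Lemma closed_unit_spaceP (C : set (unit_space E)) :
  closed C <->
  forall x, ~ C x ->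
    exists mu F, [/\ finite_set F, F `<=` out_edges (prange mu),
      cylinder_minus mu F x & cylinder_minus mu F `<=` ~` C].
Proof.
rewrite -openC open_unit_spaceP; split=> [[D Db DC] x Cx|nC].
  have [B DB Bx] : (\bigcup_(B in D) B) x by rewrite DC.
  have [mu [F [Ff Fmu BE]]] := Db _ DB; exists mu, F.
  by rewrite -BE; split=> // y By; rewrite -DC; exists B.
exists [set B | basic_sets B /\ B `<=` ~` C]; first by move=> B [].
apply/seteqP; split=> [x [B [_ BC] /BC//]|x /nC[mu [F [Ff Fmu xF FC]]]].
by exists (cylinder_minus mu F) => //; split=> //; exists mu, F.
Qed.

End UnitSpace.

(** * Membership in U_{H,S} and reachability of H *)

Section UPair.
Context {E : digraph} {H S : set (vertex E)}.
Hypothesis hH : hereditary H.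
Hypothesis SB : S `<=` breaking_vertices H.
Implicit Types (mu nu : finite_path E) (x y z : unit_space E).

Lemma pvertexS mu n e :
  onth (pedges mu) n = Some e -> pvertex mu n.+1 = erange e.
Proof.
rewrite /pvertex; elim: (pedges mu) (psource mu) n => [|f l IH] v [|n] //=.
  by rewrite take0 => -[->].
exact: IH.
Qed.

(** Treats finite and infinite points uniformly, through their edges. *)
Lemma U_hereditaryP x :
  U_hereditary H x <->
  H (usource x) \/ exists i e, uedge x i = Some e /\ H (erange e).
Proof.
case: x => [x|mu p] /=; split.
- by move=> [[|n] Hn]; [left|right; exists n, (iedge x n)].
- by move=> [H0|[i [e [[<-] He]]]]; [exists 0|exists i.+1].
- move=> [[|n] nmu]; first by rewrite /pvertex take0; left.
  have : onth (pedges mu) n by rewrite onthTE.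
  case en: onth => [e|//] _; rewrite (pvertexS en); right.
  by exists n, e.
- move=> [H0|[i [e [ie He]]]]; first by exists 0; rewrite // /pvertex take0.
  by exists i.+1; rewrite ?(pvertexS ie) // /plength -onthTE ie.
Qed.

Lemma hereditary_walk v (l : seq (edge E)) :
  walk v l -> H v -> H (last v (map (@erange E) l)).
Proof. by move=> w; exact: (hH (mu := FinitePath w)). Qed.

(** Once [mu] meets [H] it stays in [H] by heredity, so [x] starts in [H]; any other visit to [H]
    occurs along [x], shifted by the length of [mu]. *)
Lemma U_hereditary_ucat mu x (h : usource x = prange mu) :
  U_hereditary H (ucat h) <-> U_hereditary H x.
Proof.
rewrite !U_hereditaryP; split.
  move=> [|[i [e]]]; first by rewrite usource_ucat h => Hmu; left; exact: hH.
  have [imu|mui] := ltnP i (plength mu); last first.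
    by rewrite -(subnKC mui) uedge_ucat => ?; right; exists (i - plength mu), e.
  have c : cylinder mu (ucat h) by exists x, h.
  rewrite (cylinder_edge c imu) h /prange => -[ie He]; left.
  move: (pedgesP mu) ie.
  elim: (pedges mu) (psource mu) i {imu} => [|f l IH] v [|i] //=.
    by move=> [_ w] [fe]; subst f; exact: hereditary_walk.
  by move=> [_ w]; exact: IH.
move=> [|[i [e ie]]]; last by right; exists (plength mu + i), e; rewrite uedge_ucat.
rewrite h => Hmu; have [mu0|mu0] := posnP (plength mu).
  left; move: Hmu; rewrite usource_ucat /prange.
  by move: mu0; rewrite /plength; case: (pedges mu).
(* For [mu] of positive length, the source of [x] is the range of the last edge of [mu], whose index
   from 0 is one less than the length. *)
have : onth (pedges mu) (plength mu).-1 by rewrite onthTE prednK.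
case ie: onth => [e|//] _; right; exists (plength mu).-1, e; split.
  by rewrite (@cylinder_edge _ mu) ?prednK //; exists x, h.
by rewrite -(pvertexS ie) prednK // /pvertex take_size.
Qed.

Lemma U_pair_ucat mu x (h : usource x = prange mu) :
  U_pair H S (ucat h) <-> U_pair H S x.
Proof.
have bE : U_breaking S (ucat h) <-> U_breaking S x.
  by case: x h => //= nu p h; rewrite prange_pcat.
by split=> -[/U_hereditary_ucat ?|/bE ?]; [left|right|left|right].
Qed.

Lemma U_pair_source x : H (usource x) -> U_pair H S x.
Proof. by move=> Hx; left; apply/U_hereditaryP; left. Qed.

Lemma paths_U_pair (v : vertex E) :
  paths v H !=set0 <-> exists2 x, U_pair H S x & usource x = v.
Proof.
split=> [[mu [<- Hmu]]|[x Ux <-]].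
  have [x xmu] := exists_usource (prange mu).
  exists (ucat xmu); last exact: usource_ucat.
  by apply/U_pair_ucat/U_pair_source; rewrite xmu.
case: Ux => [|]; last first.
  case: x => // mu p /= /SB[_ inf _ fin].
  (* Only finitely many of the infinitely many edges emitted by a breaking vertex end outside
     [H]. *)
  have [e [emu He]] : exists e, esource e = prange mu /\ H (erange e).
    apply: contrapT => /forallNP ne; apply: inf; apply: sub_finite_set fin.
    by move=> e emu; split=> // He; apply: (ne e).
  by exists (@pcat E mu (edge_path e) emu); split=> //; rewrite prange_pcat.
case: x => [x [n Hn]|mu p [n nmu Hn]].
  have [mu [y [h [xE _ muE]]]] := UInfinite_ucat x n.
  by exists mu; rewrite xE usource_ucat; split=> //; rewrite muE.
(* The truncation of [mu] after [n] edges is a path ending in [H]. *)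
have := pedgesP mu; rewrite -{1}(cat_take_drop n (pedges mu)).
by move=> /walk_cat[w _]; exists (FinitePath w).
Qed.

Lemma paths_edge_U_pair e : paths (erange e) H !=set0 ->
  exists x, [/\ U_pair H S x, usource x = esource e & uedge x 0 = Some e].
Proof.
move=> /paths_U_pair[x Ux xe].
exists (@ucat E (edge_path e) x xe); split; last exact: uedge_ucat_edge.
  exact/U_pair_ucat.
exact: usource_ucat.
Qed.

Lemma U_pair_edge x e : U_pair H S x -> uedge x 0 = Some e ->
  paths (erange e) H !=set0.
Proof.
move=> Ux /uedge0_Some[y [h xE]]; subst x; apply/paths_U_pair.
by exists y => //; apply/(U_pair_ucat h).
Qed.

Lemma U_pair_vertex_path (v : vertex E) p :
  U_pair H S (UFinite (vertex_path v) p) <-> (H `|` S) v.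
Proof.
split=> [[[n _]|]|[|]]; [by left|by right|by move=> ?; exact: U_pair_source|].
by right.
Qed.

(** If [H] were reachable through an edge outside [F], some point of U_{H,S} would begin with that
    edge, and prefixing [mu] to it would give a point of both sets. *)
Lemma cylinder_minus_disjoint mu (F : set (edge E)) e :
  F `<=` out_edges (prange mu) ->
  cylinder_minus mu F `<=` ~` U_pair H S ->
  ~ F e -> esource e = prange mu -> paths (erange e) H = set0.
Proof.
move=> Fmu FU nFe emu; apply/seteqP; split=> // nu eH.
have [x [Ux xe x0]] : exists x,
    [/\ U_pair H S x, usource x = esource e & uedge x 0 = Some e].
  by apply: paths_edge_U_pair; exists nu.
have h : usource x = prange mu by rewrite xe.
apply: (FU (ucat h)); last exact/U_pair_ucat.
apply/cylinder_minusP => //; exists x, h; split=> // f Ff.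
by rewrite x0 => -[ef]; apply: nFe; rewrite ef.
Qed.

(** * Closedness implies (i) and (ii) *)

Lemma closed_U_pair_infinite (x : infinite_path E) :
  closed (U_pair H S) -> ivertices x `<=` ~` H ->
  exists N : nat, paths (ivertex x N) H = set0.
Proof.
move=> /closed_unit_spaceP cU xH.
have /cU[mu [F [_ Fmu xF FU]]] : ~ U_pair H S (UInfinite x).
  by move=> [[n Hn]|//]; apply: (xH (ivertex x n)) => //; exists n.
have [y [h [xE nF]]] := (cylinder_minusP _ Fmu).1 xF.
have y0 : uedge y 0 = Some (iedge x (plength mu)).
  by rewrite -(uedge_ucat h) -xE addn0.
(* The edge of [x] following [mu] is outside [F], so [H] is unreachable from its range; from the
   range of [mu] it may still be reachable through [F]. *)
exists (plength mu).+1; apply: (cylinder_minus_disjoint Fmu FU).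
  by move=> /nF.
have [z [k yE]] := uedge0_Some y0.
by rewrite -h yE usource_ucat.
Qed.

Lemma closed_U_pair_emitter (v : vertex E) :
  closed (U_pair H S) ->
  infinite_set [set e : edge E |
    esource e = v /\ paths (erange e) H !=set0] ->
  (H `|` S) v.
Proof.
move=> /closed_unit_spaceP cU inf; apply: contrapT => nv.
have p : sink (prange (vertex_path v)) \/
    infinite_emitter (prange (vertex_path v)).
  by right; apply: contra_not inf; apply: sub_finite_set => e [].
have /cU[mu [F [Ff Fmu vF FU]]] : ~ U_pair H S (UFinite (vertex_path v) p).
  by move=> /U_pair_vertex_path.
(* A point of length 0 lies in Z(mu) only when [mu] has length 0 too. *)
have muv : prange mu = v.
  have [[y|nu q] [h [vE _]]] := (cylinder_minusP _ Fmu).1 vF; first by [].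
  move: vE => [-> ]; rewrite /prange; case: (pedges mu) => //.
(* Every edge from [v] leading to [H] must lie in the finite set [F]. *)
apply: inf; apply: sub_finite_set Ff => e [ev [nu eH]].
apply: contrapT => nFe.
have := cylinder_minus_disjoint Fmu FU nFe; rewrite muv => /(_ ev) e0.
by move: eH; rewrite e0.
Qed.

(** * Neighbourhoods that miss U_{H,S} *)

Lemma U_pair_nbhs_infinite (x : infinite_path E) N :
  paths (ivertex x N) H = set0 ->
  exists mu, cylinder_minus mu set0 (UInfinite x) /\
    cylinder_minus mu set0 `<=` ~` U_pair H S.
Proof.
(* Take for [mu] the first [N] edges of [x]: a point of U_{H,S} in Z(mu) would have a tail in
   U_{H,S} starting at the [N]-th vertex, making [H] reachable from there. *)
move=> x0; have [mu [y [h [xE _ muN]]]] := UInfinite_ucat x N; exists mu.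
have s0 : set0 `<=` out_edges (prange mu) by [].
split; first by apply/(cylinder_minusP _ s0); exists y, h.
move=> _ /(cylinder_minusP _ s0)[z [k [-> _]]] /U_pair_ucat Uz.
have : paths (ivertex x N) H !=set0 by apply/paths_U_pair; exists z; rewrite ?k.
by rewrite x0 => -[].
Qed.

(** A point mu y of U_{H,S} either continues past [mu] by an edge leading to [H], which [F]
    excludes, or is [mu] itself. Finiteness of [F] is left to condition (ii). *)
Lemma U_pair_nbhs_finite mu p :
  ~ U_pair H S (UFinite mu p) ->
  let F := [set e | esource e = prange mu /\ paths (erange e) H !=set0] in
  cylinder_minus mu F (UFinite mu p) /\
  cylinder_minus mu F `<=` ~` U_pair H S.
Proof.
move=> nU F; have Fmu : F `<=` out_edges (prange mu) by move=> e [].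
have [q [h muE]] := UFinite_ucat p.
split.
  apply/(cylinder_minusP _ Fmu).
  by exists (UFinite (vertex_path (prange mu)) q), h.
move=> _ /(cylinder_minusP _ Fmu)[y [k [-> nF]]] /U_pair_ucat Uy.
case y0 : (uedge y 0) => [e|].
  apply: (nF e) => //; split; last exact: (U_pair_edge Uy).
  by have [z [l yE]] := uedge0_Some y0; rewrite -k yE usource_ucat.
have [q' yE] := uedge0_None y0.
apply: nU; rewrite muE; apply/U_pair_ucat/U_pair_vertex_path; rewrite -k.
by move: Uy; rewrite {1}yE => /U_pair_vertex_path.
Qed.

End UPair.

Theorem proposition4p1 (E : digraph) (H S : set (vertex E))
    (HS : admissible_pairs (H, S)) :
  closed (U_pair H S) <->
  (forall x : infinite_path E, ivertices x `<=` ~` H ->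
     exists N : nat, paths (ivertex x N) H = set0) /\
  (forall v : vertex E,
     infinite_set [set e : edge E |
       esource e = v /\ paths (erange e) H !=set0] ->
     (H `|` S) v).
Proof.
have [/= hH _ SB] := HS; split=> [cU|[xinf vinf]].
  split=> [x|v]; first exact: (closed_U_pair_infinite hH SB).
  exact: (closed_U_pair_emitter hH SB).
apply/closed_unit_spaceP => -[x nU|mu p nU].
  have [_ [n _ <-] Hn|N x0] := xinf x; first by apply: nU; left; exists n.
  have [mu [mux muU]] := U_pair_nbhs_infinite hH SB x0.
  by exists mu, set0; split=> //; exact: finite_set0.
have [muF FU] := U_pair_nbhs_finite hH SB nU.
exists mu, [set e | esource e = prange mu /\ paths (erange e) H !=set0].
split=> //; last by move=> e [].
(* Were this set infinite, (ii) would put the range of [mu] in H or S, and hence [mu] in U_{H,S}. *)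
apply: contra_notP nU => /vinf HSmu.
have [q [h ->]] := UFinite_ucat p.
by apply/(U_pair_ucat hH)/U_pair_vertex_path.
Qed.
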